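(* Define the sequence $a_n$ by $a_1 = 1$ and $a_n = M_n + m_n$, where $$M_n = \max_{1 \le i < n} (a_i + a_{n-i}), \qquad m_n = \min_{1 \le i < n} (a_i + a_{n-i}),$$ with the convention $m_1 = 1$. Let further $b_n$ be the number of partitions of $2n$ into powers of $2$ (the number of binary partitions). Then $$m_n = \tfrac{3}{2} b_{n-1} - 1, \qquad M_n = n + \sum_{k=1}^{n-1} m_k, \qquad a_n = M_{n+1} - 1.$$
   Context: The sequence is indexed by integers $n \ge 1$; the relation $a_n = M_n + m_n$ and the max/min definitions of $M_n$ and $m_n$ apply for $n \ge 2$. A partition of $2n$ into powers of $2$ (a binary partition) is a multiset of powers of two (from $\{1,2,4,8,\dots\}$) with sum $2n$; for example $b_1 = 2$ and $b_2 = 4$.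
   Formalization: The convention m_1 = 1 is replaced by m_1 = 0, since with m_1 = 1 the formula for M_n fails (M_2 = 2, but 2 + m_1 = 3); the formulas for m_n and M_n are stated for n ≥ 2 (at n = 1 the first fails and M_1 is undefined), and a_n = M_{n+1} − 1 for n ≥ 1. *)

(* Defs.v *)
From mathcomp Require Import all_boot all_order all_algebra.

Set Implicit Arguments.
Unset Strict Implicit.
Unset Printing Implicit Defensive.

(* M_n, meaningful for n >= 2. *)
Definition max_split (a : nat -> nat) (n : nat) : nat :=
  \max_(1 <= i < n) (a i + a (n - i)).

(* m_n. For n >= 2 the range 1 <= i < n is nonempty and the default value
   a 1 + a n.-1 of the iterated minimum is its i = 1 term, so it does not affect
   the result. The value m_1 := 0 is a convention: it is the only one for which
   M_n = n + \sum_(1 <= k < n) m_k holds (M_2 = 2 forces m_1 = 0). *)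
Definition min_split (a : nat -> nat) (n : nat) : nat :=
  if n == 1 then 0
  else \big[minn/a 1 + a n.-1]_(1 <= i < n) (a i + a (n - i)).

(* a 0 is left unconstrained; it is never used. *)
Definition max_min_sequence (a : nat -> nat) : Prop :=
  a 1 = 1 /\ forall n, 2 <= n -> a n = max_split a n + min_split a n.

(* A multiset of powers of two is given by the multiplicity c k of each 2 ^ k.
   If the sum is N, then c k <= N and only exponents k <= N can occur, as
   k < 2 ^ k. *)
Definition binary_partitions (N : nat) : {set {ffun 'I_N.+1 -> 'I_N.+1}} :=
  [set c : {ffun 'I_N.+1 -> 'I_N.+1} | \sum_(k < N.+1) c k * 2 ^ k == N].

Definition num_binary_partitions (n : nat) : nat := #|binary_partitions (2 * n)|.

(* Main.v *)
Require Import Defs.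
From mathcomp Require Import all_boot all_order all_algebra.
From mathcomp Require Import zify lra.

(** The sequence is convex: once [a] is convex on [1, n - 1], the maximum [M_n]
    is attained at the extreme split [1 + (n - 1)] and the minimum [m_n] at the
    balanced one, so [a_n - a_(n-1) = 1 + m_n], and these increments are
    monotone because [a] is increasing.  Hence
    [m_(n+1) - m_n = a_(n/2 + 1) - a_(n/2) = 1 + m_(n/2 + 1)] (with [n/2] rounded
    down), which for [3/2 b_(n-1) = m_n + 1] is the recurrence
    [b_n = b_(n-1) + b_(n/2)] of binary partitions. *)

Section Convexity.

Variable a : nat -> nat.

Definition convex_upto (n : nat) :=
  forall k, 0 < k -> k.+2 <= n -> a k.+1 + a k.+1 <= a k + a k.+2.

Lemma convex_increment n i j : convex_upto n -> 0 < i -> i <= j -> j < n ->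
  a i.+1 + a j <= a i + a j.+1.
Proof.
move=> cvx i_gt0; elim: j => [|j IHj] le_ij lt_jn; first by lia.
have [->|lt_ij] : i = j.+1 \/ i <= j by lia.
  by rewrite addnC.
have := IHj lt_ij (ltnW lt_jn); have := cvx j; lia.
Qed.

(** Move the inner pair outward one unit at a time: by [convex_increment] no such step lowers the
    sum. *)
Lemma convex_spread n p i j q : convex_upto n -> 0 < p -> p <= i -> i <= j ->
  i + j = p + q -> q <= n -> a i + a j <= a p + a q.
Proof.
move=> cvx p_gt0 le_pi; rewrite -(subnKC le_pi).
elim: (i - p) j => [|d IHd] j le_ij eq_ij le_qn.
  have -> : j = q by lia.
  by rewrite addn0.
have := IHd j.+1; have := convex_increment n (p + d) j cvx; rewrite [p + d.+1]addnS; lia.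
Qed.

Lemma max_split_convex n : 2 <= n -> convex_upto n.-1 ->
  max_split a n = a 1 + a n.-1.
Proof.
move=> n_ge2 cvx; apply/eqP; rewrite eqn_leq /max_split; apply/andP; split.
  apply/bigmax_leqP_seq => i; rewrite mem_index_iota => /andP[i_gt0 lt_in] _.
  have [le_i|/ltnW le_i] := leqP i (n - i).
    by apply: (convex_spread n.-1); lia || exact: cvx.
  by rewrite addnC; apply: (convex_spread n.-1); lia || exact: cvx.
rewrite -subn1.
by apply: (leq_bigmax_seq (F := fun i => a i + a (n - i))); rewrite ?mem_index_iota ?n_ge2.
Qed.

Lemma min_split_convex n : 2 <= n -> convex_upto n.-1 ->
  min_split a n = a n./2 + a (uphalf n).
Proof.
move=> n_ge2 cvx; rewrite /min_split ifN; last by lia.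
have half_le i j : 0 < i -> 0 < j -> i + j = n ->
    a n./2 + a (uphalf n) <= a i + a j.
  wlog le_ij : i j / i <= j.
    move=> wl i_gt0 j_gt0 eq_ij; have [|/ltnW] := leqP i j => /wl; first exact.
    by rewrite [a i + _]addnC; apply=> //; lia.
  by move=> i_gt0 j_gt0 eq_ij; apply: (convex_spread n.-1); lia || exact: cvx.
apply/eqP; rewrite eqn_leq; apply/andP; split; last first.
  (* The default value of the minimum is the split sum at i = 1, so [half_le] bounds it too. *)
  rewrite big_seq; elim/big_ind: _ => [|x y le_x le_y|i].
  - by apply: half_le; lia.
  - by rewrite leq_min le_x.
  - by rewrite mem_index_iota => /andP[i_gt0 lt_in]; apply: half_le; lia.
have -> : uphalf n = n - n./2 by lia.
have : n./2 \in index_iota 1 n by rewrite mem_index_iota; lia.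
elim: (index_iota 1 n) => //= i r IHr; rewrite big_cons inE geq_min.
by case/predU1P=> [<-|/IHr->]; rewrite ?leqnn ?orbT.
Qed.

End Convexity.

Section MaxMinSequence.

Variables (a : nat -> nat) (ha : max_min_sequence a).

(** Convexity up to n - 1 locates both extreme splits of every index up to n, which gives [rec];
    second differences of [a] are then differences of consecutive minima. *)
Lemma max_min_sequence_convex n : convex_upto a n.
Proof.
elim/ltn_ind: n => n IHn k k_gt0 le_kn.
have rec j : 2 <= j <= n -> a j = a 1 + a j.-1 + (a j./2 + a (uphalf j)).
  case/andP=> j_ge2 le_jn; have cvx : convex_upto a j.-1 by apply: IHn; lia.
  by rewrite ha.2 // max_split_convex ?min_split_convex.
have mono j : 0 < j < n -> a j <= a j.+1 by move=> /rec /= ->; lia.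
(* From [k.+1] to [k.+2] only one half of the balanced split changes, from [uphalf k] to
   [(uphalf k).+1]. *)
have := mono (uphalf k) ltac:(lia).
have := rec k.+2 ltac:(lia); have := rec k.+1 ltac:(lia).
rewrite /=; lia.
Qed.

Lemma max_split_seq n : 2 <= n -> max_split a n = (a n.-1).+1.
Proof.
move=> n_ge2; rewrite max_split_convex ?ha.1 ?add1n //.
exact: max_min_sequence_convex.
Qed.

Lemma min_split_seq n : 2 <= n -> min_split a n = a n./2 + a (uphalf n).
Proof.
by move=> n_ge2; apply: min_split_convex => //; apply: max_min_sequence_convex.
Qed.

Lemma max_min_sequenceS n : 0 < n -> a n.+1 = a n + (min_split a n.+1).+1.
Proof. by move=> n_gt0; rewrite ha.2 // max_split_seq //= addSn addnS. Qed.

Lemma max_min_sequence_sum n :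
  0 < n -> a n = n + \sum_(1 <= k < n.+1) min_split a k.
Proof.
(* The base case relies on the convention [min_split a 1 = 0]. *)
elim: n => // -[_ _|n IHn _]; first by rewrite ha.1 big_nat1.
by rewrite max_min_sequenceS // IHn // [in RHS]big_nat_recr //=; lia.
Qed.

Lemma min_splitS n : 2 <= n ->
  min_split a n.+1 = min_split a n + (min_split a n./2.+1).+1.
Proof.
move=> n_ge2; rewrite (min_split_seq n.+1) ?(min_split_seq n) ?leqW //=.
by have := max_min_sequenceS n./2 ltac:(lia); lia.
Qed.

End MaxMinSequence.

Section BinaryPartitions.

(** [binary_partitions] ties both bounds to [N]; here they are independent, so that induction can
    lower [K] with [B] fixed. *)
Definition binary_weight (K B : nat) (c : {ffun 'I_K -> 'I_B}) : nat :=
  \sum_(k < K) c k * 2 ^ k.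

(* Number of binary partitions of [N] with all parts smaller than [2 ^ K]. *)
Fixpoint bounded_partitions (K N : nat) : nat :=
  if K is K'.+1 then \sum_(i < N./2.+1) bounded_partitions K' i else N == 0.

Lemma sum_nat_eq (n m : nat) : \sum_(i < n) (m == i :> nat) = (m < n).
Proof.
have [lt_mn|le_nm] := ltnP m n.
  rewrite (bigD1 (Ordinal lt_mn)) //= eqxx big1 // => i.
  by rewrite -val_eqE /= eq_sym => /negPf->.
by rewrite big1 // => i _; have := ltn_ord i; lia.
Qed.

Lemma sum_binary_weight_eq K B N : N < B ->
  \sum_(c : {ffun 'I_K -> 'I_B}) (binary_weight K B c == N)
    = bounded_partitions K N.
Proof.
elim: K N => [|K IHK] N lt_NB.
  rewrite (eq_bigr (fun=> (N == 0 : nat))) => [|c _].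
    by rewrite sum_nat_const card_ffun !card_ord expn0 mul1n.
  by rewrite /binary_weight big_ord0 eq_sym.
(* Split off the number [j] of parts equal to 1, which the rest determines. *)
pose glue (p : 'I_B * {ffun 'I_K -> 'I_B}) : {ffun 'I_K.+1 -> 'I_B} :=
  [ffun k => oapp p.2 p.1 (unlift ord0 k)].
have glue_bij : bijective glue.
  exists (fun c : {ffun _ -> _} => (c ord0, [ffun k => c (lift ord0 k)])) => [[j c]|c].
    by congr pair; [|apply/ffunP=> k]; rewrite !ffunE ?unlift_none ?liftK.
  apply/ffunP=> k; rewrite ffunE.
  by case: unliftP => [k' ->|->] /=; rewrite ?ffunE.
have weight_glue j c :
    binary_weight K.+1 B (glue (j, c)) = j + (binary_weight K B c).*2.
  rewrite /binary_weight big_ord_recl ffunE unlift_none muln1; congr addn.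
  rewrite -muln2 big_distrl; apply: eq_bigr => k _ /=.
  by rewrite ffunE liftK /= expnSr mulnA.
rewrite (reindex glue) /=; last exact: onW_bij.
transitivity (\sum_(j < B) \sum_(c : {ffun 'I_K -> 'I_B})
                (j + (binary_weight K B c).*2 == N)).
  by rewrite pair_bigA; apply: eq_bigr => -[j c] _; rewrite weight_glue.
rewrite exchange_big /=.
transitivity (\sum_(i < N./2.+1) \sum_(c : {ffun 'I_K -> 'I_B})
                (binary_weight K B c == i)); last first.
  by apply: eq_bigr => i _; apply: IHK; have := ltn_ord i; lia.
(* For fixed [c] of weight w, both sides are the indicator of 2w <= N: on the left only j = N - 2w
   contributes, and it lies below [B] since [N < B]. *)
rewrite [RHS]exchange_big; apply: eq_bigr => c _ /=.
rewrite sum_nat_eq ltnS.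
have [le_wN|lt_Nw] := leqP (binary_weight K B c) N./2.
  transitivity (\sum_(j < B) (N - (binary_weight K B c).*2 == j)).
    by apply: eq_bigr => j _; lia.
  by rewrite sum_nat_eq; lia.
by rewrite big1 // => j _; lia.
Qed.

(** No part of a partition of [N] exceeds N < 2 ^ N, so larger exponents add nothing. *)
Lemma bounded_partitions_stable K N :
  N <= K -> bounded_partitions K N = bounded_partitions N N.
Proof.
have stable n : forall M, M <= n -> bounded_partitions n.+1 M = bounded_partitions n M.
  elim: n => [|n IHn] M le_Mn.
    have -> : M = 0 by lia.
    by rewrite /= big_ord1.
  by apply: eq_bigr => i _; apply: IHn; have := ltn_ord i; lia.
elim: K => [|K IHK]; first by case: N.
rewrite leq_eqVlt ltnS => /predU1P[-> //|le_NK].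
by rewrite stable ?IHK.
Qed.

Lemma card_binary_partitions N :
  #|binary_partitions N| = bounded_partitions N N.
Proof.
rewrite -(bounded_partitions_stable N.+1) // -(sum_binary_weight_eq _ N.+1) //.
rewrite -sum1dep_card big_mkcond /=.
by apply: eq_bigr => c _; rewrite /binary_weight; case: eqP.
Qed.

Lemma binary_partitions_half N :
  #|binary_partitions N| = \sum_(i < N./2.+1) #|binary_partitions i|.
Proof.
rewrite card_binary_partitions -(bounded_partitions_stable N.+1) //=.
apply: eq_bigr => i _; rewrite card_binary_partitions.
by apply: bounded_partitions_stable; have := ltn_ord i; lia.
Qed.

Lemma num_binary_partitions0 : num_binary_partitions 0 = 1.
Proof. by rewrite /num_binary_partitions muln0 card_binary_partitions. Qed.

(** The sum in [binary_partitions_half] depends on [N] only through [N./2], which is also the half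
    of [2 * N./2]. *)
Lemma num_binary_partitions_half N :
  #|binary_partitions N| = num_binary_partitions N./2.
Proof.
rewrite binary_partitions_half [RHS]binary_partitions_half.
by rewrite mul2n doubleK.
Qed.

(** The half-sums for 2n + 2 and 2n differ by their last term, the number of binary partitions of n
    + 1. *)
Lemma num_binary_partitionsS n : num_binary_partitions n.+1
  = num_binary_partitions n + num_binary_partitions n.+1./2.
Proof.
rewrite -num_binary_partitions_half {1 2}/num_binary_partitions.
rewrite binary_partitions_half [#|binary_partitions (2 * n)|]binary_partitions_half.
by rewrite !mul2n !doubleK big_ord_recr.
Qed.

End BinaryPartitions.

(** Both sides obey the same recurrence, by [min_splitS] and [num_binary_partitionsS]; doubling
    keeps the factor 3/2 within [nat]. *)
Lemma min_split_num_binary_partitions (a : nat -> nat) (n : nat) :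
  max_min_sequence a -> 0 < n ->
  2 * (min_split a n.+1).+1 = 3 * num_binary_partitions n.
Proof.
move=> ha; elim/ltn_ind: n => -[|[_ _|n IHn _]] //.
  (* The case n = 1 is computed directly, m_2 = 2 and b_1 = 2, because [min_splitS] starts at index
     2. *)
  rewrite (min_split_seq _ ha) //= ha.1 num_binary_partitionsS.
  by rewrite num_binary_partitions0.
rewrite (min_splitS _ ha) // num_binary_partitionsS.
have := IHn n.+1 ltac:(lia) ltac:(lia); have := IHn n.+2./2 ltac:(lia) ltac:(lia).
lia.
Qed.

Import GRing.Theory.
Local Open Scope ring_scope.

Theorem mainTheorem2 (a : nat -> nat) (ha : max_min_sequence a) :
  [/\ forall n : nat, (2 <= n)%N ->
        (min_split a n)%:R
          = 3%:R / 2%:R * (num_binary_partitions n.-1)%:R - 1 :> rat,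
      forall n : nat, (2 <= n)%N ->
        max_split a n = (n + \sum_(1 <= k < n) min_split a k)%N
    & forall n : nat, (1 <= n)%N ->
        (a n)%:R = (max_split a n.+1)%:R - 1 :> rat].
Proof.
split=> [[|n] // n_gt0|[|n] // n_gt0|n n_gt0].
- have /(congr1 (fun m : nat => m%:R : rat)) :=
    min_split_num_binary_partitions a n ha n_gt0.
  by rewrite !natrM -[(min_split _ _).+1%:R]natr1 /=; lra.
- by rewrite (max_split_seq _ ha) //= {1}(max_min_sequence_sum _ ha).
- by rewrite (max_split_seq _ ha) //= -natr1 addrK.
Qed.
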